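(* Let $n$ and $\nu$ be integers with $0\le \nu\le n-2$. If $G$ is a graph with maximum value of the Sombor index $SO$ among all $n$-vertex graphs with cyclomatic number $\nu$, then $G\cong H_{n,\nu}$ and $$SO(G)=(n-\nu-2)\sqrt{(n-1)^2+1}+\nu\sqrt{(n-1)^2+4}+\sqrt{(n-1)^2+(\nu+1)^2}+\nu\sqrt{(\nu+1)^2+4}.$$
   Context: All graphs are finite, undirected and simple. $\deg_G(v)$ denotes the degree of the vertex $v$ in $G$. The Sombor index of $G$ is $SO(G)=\sum_{uv\in E(G)}\sqrt{\deg_G(u)^2+\deg_G(v)^2}$. The cyclomatic number of a graph with $n$ vertices, $m$ edges and $c$ connected components is $m-n+c$. $S_n$ is the star on $n$ vertices (one center adjacent to the other $n-1$ vertices, which are called pendent). For $n\ge 2$ and $0\le\nu\le n-2$, $H_{n,\nu}$ is the graph obtained from the star $S_n$ by adding $\nu$ edges between one fixed pendent vertex and $\nu$ other pendent vertices. *)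

(* Defs.v *)
From mathcomp Require Import all_boot all_order all_algebra.
Set Implicit Arguments.
Unset Strict Implicit.
Unset Printing Implicit Defensive.
Import GRing.Theory Num.Theory.
Local Open Scope ring_scope.

Record sgraph := SGraph {
  vertex :> finType;
  adj : rel vertex;
  adj_sym : symmetric adj;
  adj_irr : irreflexive adj }.

Definition edges (G : sgraph) : {set {set G}} :=
  [set [set u; v] | u in G, v in G & adj u v].

Definition deg (G : sgraph) (v : G) : nat := #|[set u | adj v u]|.

Definition sombor (R : rcfType) (G : sgraph) : R :=
  \sum_(e in edges G) Num.sqrt (\sum_(v in e) (deg v)%:R ^+ 2).

(* The summand of [sombor] at the edge uv. *)
Lemma sombor_summand (R : rcfType) (G : sgraph) (u v : G) : adj u v ->
  Num.sqrt (\sum_(w in [set u; v]) (deg w)%:R ^+ 2)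
  = Num.sqrt ((deg u)%:R ^+ 2 + (deg v)%:R ^+ 2) :> R.
Proof.
move=> uv; rewrite big_setU1 ?big_set1 // inE.
by apply: contraTneq uv => ->; rewrite adj_irr.
Qed.

Definition num_components (G : sgraph) : nat := n_comp (@adj G) G.

Definition cyclomatic (G : sgraph) : int :=
  #|edges G|%:Z - #|G|%:Z + (num_components G)%:Z.

Definition isomorphic (G H : sgraph) : Prop :=
  exists2 f : G -> H, bijective f & forall u v, adj (f u) (f v) = adj u v.

(* Vertex 0 is the center. *)
Definition star_adj (n : nat) : rel 'I_n :=
  fun i j => (i != j) && ((val i == 0%N) || (val j == 0%N)).

(* Vertex 1 is the fixed pendent vertex; it is joined to 2, ..., nu + 1, which
   are nu vertices of 'I_n exactly when nu + 2 <= n (or nu = 0). *)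
Definition added_adj (n nu : nat) : rel 'I_n :=
  fun i j => ((val i == 1%N) && (2 <= val j < nu + 2)%N)
          || ((val j == 1%N) && (2 <= val i < nu + 2)%N).

Definition H_adj (n nu : nat) : rel 'I_n :=
  fun i j => star_adj i j || added_adj nu i j.

Lemma H_adj_sym n nu : symmetric (@H_adj n nu).
Proof.
move=> i j; rewrite /H_adj /star_adj /added_adj eq_sym.
by rewrite (orbC (val i == 0%N)) (orbC (_ && (2 <= val j < _)%N)).
Qed.

Lemma H_adj_irr n nu : irreflexive (@H_adj n nu).
Proof.
by move=> i; rewrite /H_adj /star_adj /added_adj eqxx; case: (val i) => [|[|?]].
Qed.

Definition Hgraph (n nu : nat) : sgraph :=
  SGraph (@H_adj_sym n nu) (@H_adj_irr n nu).

Definition sombor_maximal (R : rcfType) (n nu : nat) (G : sgraph) : Prop :=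
  [/\ #|G| = n, cyclomatic G = nu%:Z
    & forall G' : sgraph, #|G'| = n -> cyclomatic G' = nu%:Z ->
        sombor R G' <= sombor R G].

(* Main.v *)
Require Import Defs.
From mathcomp Require Import all_boot all_order all_algebra.
From mathcomp Require Import zify ring lra.
Import Order.TTheory GRing.Theory Num.Theory.
Local Open Scope ring_scope.

(** Write f(x, y) = sqrt (x^2 + y^2).  A maximal graph is connected: joining a
    vertex u to one vertex of each component not containing u keeps the cyclomatic
    number and increases the index.  If a and v are adjacent or have a common
    neighbour, and deg v <= deg a, then every neighbour of v is a or a neighbour
    of a: otherwise moving the other neighbours of v to a keeps the graph
    connected and, as f(_, c) is convex, increases the index.  Hence a vertex u of
    maximal degree dominates the graph, and if a has the largest degree among the
    others, every edge avoiding u and a lies inside K = N(a) \ {u}.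

    Let N = deg u, k = #|K|, and let e = nu - k be the number of edges inside K.
    If e > 0 the graph has smaller index than H.  With A = k + e + 1 and
    F = f(A, 2), every other edge not at u is compared with F through
    F - f >= (F^2 - f^2) / (2F), and the edges at u are compared through the slope
    sg = (k + 1) / f(N, k + 1) of f(N, _) at k + 1: their total drops by less than
    e * sg when passing to H, and sg * F <= k + 1 since A <= N.  What remains is a
    polynomial inequality in k >= 2 and e >= 1.  If e = 0 the graph is H. *)

(** * Inequalities for the function sqrt (x^2 + y^2) *)

Definition hypot {R : rcfType} (x y : R) : R := Num.sqrt (x ^+ 2 + y ^+ 2).

Section Hypot.
Variable R : rcfType.
Implicit Types x y z c : R.

Lemma hypotC x y : hypot x y = hypot y x.
Proof. by rewrite /hypot addrC. Qed.

Lemma hypot_ge0 x y : 0 <= hypot x y.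
Proof. exact: sqrtr_ge0. Qed.

Lemma sqr_hypot x y : hypot x y ^+ 2 = x ^+ 2 + y ^+ 2.
Proof. by rewrite sqr_sqrtr // addr_ge0 ?sqr_ge0. Qed.

Lemma hypot_gt0 x y : 0 < y -> 0 < hypot x y.
Proof. by move=> y0; rewrite sqrtr_gt0 ltr_wpDl ?sqr_ge0 ?exprn_gt0. Qed.

Lemma ler_hypot x y x' y' :
  (hypot x y <= hypot x' y') = (x ^+ 2 + y ^+ 2 <= x' ^+ 2 + y' ^+ 2).
Proof. by rewrite ler_sqrt // addr_ge0 ?sqr_ge0. Qed.

Lemma ltr_hypot x y x' y' : 0 < y' ->
  (hypot x y < hypot x' y') = (x ^+ 2 + y ^+ 2 < x' ^+ 2 + y' ^+ 2).
Proof. by move=> y0; rewrite ltr_sqrt // ltr_wpDl ?sqr_ge0 ?exprn_gt0. Qed.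

(** Multiplied by [hypot x y], this is the Cauchy-Schwarz inequality for (x, y) and (x, z); the
    difference of the squares is (x (y - z))^2. So the tangent at y lies below the graph, which is
    the form of convexity used throughout. *)
Lemma hypot_tangent x y z : 0 < x ->
  hypot x y + (z - y) * (y / hypot x y) <= hypot x z.
Proof.
move=> x0.
have h0 : 0 < hypot x y by rewrite hypotC hypot_gt0.
have eqL : hypot x y + (z - y) * (y / hypot x y)
     = (x ^+ 2 + z * y) / hypot x y.
  apply: (mulIf (lt0r_neq0 h0)); rewrite mulrDl -expr2 sqr_hypot.
  by field; rewrite lt0r_neq0.
rewrite eqL ler_pdivrMr //.
apply: le_trans (ler_norm _) _.
rewrite -(ler_pXn2r (n := 2)) ?nnegrE ?mulr_ge0 ?hypot_ge0 ?normr_ge0 //.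
rewrite exprMn !sqr_hypot real_normK ?num_real //.
have := sqr_ge0 (x * (y - z)); nra.
Qed.

Lemma hypot_slope_mono x y z : 0 < x -> 0 <= y -> y <= z ->
  y / hypot x y <= z / hypot x z.
Proof.
move=> x0 y0 yz.
have hy : 0 < hypot x y by rewrite hypotC hypot_gt0.
have hz : 0 < hypot x z by rewrite hypotC hypot_gt0.
rewrite ler_pdivrMr // mulrAC ler_pdivlMr //.
rewrite -(ler_pXn2r (n := 2)) ?nnegrE ?mulr_ge0 ?hypot_ge0 ?(le_trans y0 yz) //.
rewrite !exprMn !sqr_hypot !mulrDr [z ^+ 2 * y ^+ 2]mulrC lerD2r.
by rewrite ler_wpM2r ?sqr_ge0 // ler_pXn2r ?nnegrE ?(le_trans y0 yz).
Qed.

(** Add the tangents at x and at y: the slope at the larger point x is at least the slope at y, so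
    moving t from y to x cannot lower the sum. *)
Lemma hypot_spread c x y t : 0 < c -> 0 <= t -> 0 <= y -> y <= x ->
  hypot x c + hypot y c <= hypot (x + t) c + hypot (y - t) c.
Proof.
move=> c0 t0 y0 yx; rewrite ![hypot _ c]hypotC.
have := hypot_tangent c x (x + t) c0; rewrite addrAC subrr add0r.
have := hypot_tangent c y (y - t) c0; rewrite addrAC subrr add0r.
have := ler_wpM2l t0 (hypot_slope_mono c y x c0 y0 yx); rewrite mulNr.
lra.
Qed.

(** With F and f the two values, 2F (F - f) - (F^2 - f^2) = (F - f)^2, whichever of them is
    larger. *)
Lemma hypot_gap x y x' y' : 0 < y ->
  (x ^+ 2 + y ^+ 2 - (x' ^+ 2 + y' ^+ 2)) / (2 * hypot x y)
    <= hypot x y - hypot x' y'.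
Proof.
move=> y0; have h0 := hypot_gt0 x y y0.
rewrite ler_pdivrMr ?mulr_gt0 // -!sqr_hypot.
have := sqr_ge0 (hypot x y - hypot x' y'); nra.
Qed.

End Hypot.

(** * Sums over edges as sums over ordered pairs *)

Lemma sum_edgesE (V : nmodType) (G : sgraph) (F : {set G} -> V) :
  (\sum_(e in edges G) F e) *+ 2
  = \sum_x \sum_(y | adj x y) F [set x; y].
Proof.
rewrite pair_big_dep /=.
(* The fibre of an edge consists of its two orderings, whence the factor 2. *)
rewrite (partition_big (fun p : G * G => [set p.1; p.2]) (mem (edges G))) /=; last first.
  by move=> [x y] /= xy; apply/imset2P; exists x y; rewrite ?inE.
rewrite -sumrMnl; apply: eq_bigr => e /imset2P[u v _ + ->].
rewrite inE /= => uv.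
have neq_uv : u != v by apply: contraTneq uv => ->; rewrite adj_irr.
have neq_p : (v, u) != (u, v) by rewrite xpair_eqE negb_and eq_sym neq_uv.
rewrite (bigD1 (u, v)) /= ?uv ?eqxx // (bigD1 (v, u)) /=; last first.
  by rewrite adj_sym uv neq_p setUC eqxx.
rewrite setUC big1 ?addr0 ?mulr2n // => -[x y] /= /andP[/andP[/andP[xy /eqP E] n1] n2].
have xE : x \in [set v; u] by rewrite -E !inE eqxx.
have yE : y \in [set v; u] by rewrite -E !inE eqxx orbT.
move: xE yE xy n1 n2; rewrite !inE.
by case/orP=> /eqP-> /orP[]/eqP->; rewrite ?adj_irr ?eqxx.
Qed.

Lemma ltr_sum_strict_at (R : numDomainType) (T : finType) (P : pred T) (F1 F2 : T -> R) (i : T) :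
  P i -> (forall j, P j -> F1 j <= F2 j) -> F1 i < F2 i ->
  \sum_(j | P j) F1 j < \sum_(j | P j) F2 j.
Proof.
move=> Pi le12 lt12; rewrite (bigD1 i) // [ltRHS](bigD1 i) //=.
by apply: ltr_leD => //; apply: ler_sum => j /andP[/le12].
Qed.

Lemma handshake (G : sgraph) : (\sum_(x : G) deg x)%N = (#|edges G|).*2.
Proof.
have := sum_edgesE nat G (fun=> 1%N).
rewrite sum1_card mulr2n => /esym E.
rewrite -addnn; rewrite -[RHS]E; apply: eq_bigr => x _.
by rewrite sum1_card /deg cardsE.
Qed.

(** The value 0 off the edges turns the doubled index into a double sum over all pairs, so that two
    graphs on the same vertices can be compared termwise. *)
Definition weight (R : rcfType) (G : sgraph) (x y : G) : R :=
  if adj x y then hypot (deg x)%:R (deg y)%:R else 0.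
Arguments weight R {G}.

Lemma weightC (R : rcfType) (G : sgraph) (x y : G) : weight R x y = weight R y x.
Proof. by rewrite /weight adj_sym hypotC. Qed.

Lemma weightxx (R : rcfType) (G : sgraph) (x : G) : weight R x x = 0.
Proof. by rewrite /weight adj_irr. Qed.

Lemma sombor_weight (R : rcfType) (G : sgraph) :
  sombor R G *+ 2 = \sum_(x : G) \sum_(y : G) weight R x y.
Proof.
rewrite /sombor sum_edgesE; apply: eq_bigr => x _.
rewrite big_mkcond /=; apply: eq_bigr => y _.
by rewrite /weight; case: ifP => // xy; rewrite sombor_summand.
Qed.

Lemma sum_sym_setD1 {V : nmodType} {T : finType} {h : T -> T -> V} {A : {set T}} (u : T) :
  (forall x y, h x y = h y x) -> (forall x, h x x = 0) -> u \in A ->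
  \sum_(x in A) \sum_(y in A) h x y
  = (\sum_(y in A :\ u) h u y) *+ 2 + \sum_(x in A :\ u) \sum_(y in A :\ u) h x y.
Proof.
move=> hC h0 uA; rewrite (big_setD1 u uA) /= (big_setD1 u uA) /= h0 add0r.
under [X in _ + X]eq_bigr => x _ do rewrite (big_setD1 u uA) /= hC.
by rewrite big_split /= addrA mulr2n.
Qed.

Lemma adj_deg_gt0 (G : sgraph) (x y : G) : adj x y -> (0 < deg x)%N.
Proof. by move=> xy; apply/card_gt0P; exists y; rewrite inE. Qed.

(** * Connectedness and the number of components *)

Definition connected (G : sgraph) := forall x y : G, connect (@adj G) x y.

Lemma adj_connect_sym (G : sgraph) : connect_sym (@adj G).
Proof. exact: sym_connect_sym (@adj_sym G). Qed.

Lemma connected_num_components (G : sgraph) (x : G) :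
  connected G -> num_components G = 1%N.
Proof.
move=> conG; rewrite /num_components -(n_comp_connect (@adj_connect_sym G) x).
by apply: eq_n_comp_r => y; rewrite !inE conG.
Qed.

Lemma dominating_connected (G : sgraph) (u : G) :
  (forall y, adj u y = (y != u)) -> connected G.
Proof.
move=> ud x y.
have ux z : connect (@adj G) u z.
  by have [->//|zu] := eqVneq z u; apply: connect1; rewrite ud.
by apply: connect_trans (ux y); rewrite adj_connect_sym.
Qed.

(** * Joining one vertex to a set of non-neighbours *)

Section AddStar.
Variables (G : sgraph) (u : G) (M : {set G}).
Hypothesis uM : forall x, x \in M -> ~~ adj u x && (x != u).

Definition add_star_adj : rel G :=
  fun x y => [|| adj x y, (x == u) && (y \in M) | (y == u) && (x \in M)].

Fact add_star_sym : symmetric add_star_adj.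
Proof. by move=> x y; rewrite /add_star_adj adj_sym [X in _ || X]orbC. Qed.

Fact add_star_irr : irreflexive add_star_adj.
Proof.
move=> x; rewrite /add_star_adj adj_irr /= orbb; apply/negP => /andP[/eqP-> /uM].
by rewrite eqxx andbF.
Qed.

Definition add_star := SGraph add_star_sym add_star_irr.

Lemma deg_add_star_center : @deg add_star u = (deg u + #|M|)%N.
Proof.
rewrite /deg -cardsUI [X in (_ + X)%N](_ : _ = 0%N) ?addn0.
  congr #|pred_of_set _|; apply/setP => x; rewrite !inE /= /add_star_adj eqxx /=.
  suff -> : (u \in M) = false by rewrite andbF orbF.
  by apply/negP => /uM; rewrite eqxx andbF.
apply/eqP; rewrite cards_eq0; apply/eqP/setP => x; rewrite !inE.
by apply/negP => /andP[ux /uM]; rewrite ux.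
Qed.

Lemma deg_add_star x : x != u -> @deg add_star x = (deg x + (x \in M))%N.
Proof.
move=> xu; rewrite /deg; have [xM|xM] := boolP (x \in M).
  rewrite addn1 -[LHS](cardsID [set u]) -add1n; congr (_ + _)%N.
    rewrite -(cards1 u); congr #|pred_of_set _|; apply/setP => y.
    rewrite !inE /= /add_star_adj xM (negbTE xu) /=.
    by case: (y == u); rewrite ?andbF ?orbT.
  congr #|pred_of_set _|; apply/setP => y; rewrite !inE /= /add_star_adj (negbTE xu) xM /=.
  have /andP[ux _] := uM _ xM.
  by have [->|] := eqVneq y u; rewrite ?orbF //= adj_sym (negbTE ux).
rewrite addn0; congr #|pred_of_set _|; apply/setP => y.
by rewrite !inE /= /add_star_adj (negbTE xu) (negbTE xM) andbF !orbF.
Qed.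

Lemma add_star_edges : #|edges add_star| = (#|edges G| + #|M|)%N.
Proof.
apply: double_inj; rewrite doubleD -!handshake /=.
rewrite (bigD1 u) //= [in RHS](bigD1 u) //= deg_add_star_center.
under eq_bigr => x xu do rewrite deg_add_star //.
rewrite big_split /= -addnn.
suff -> : (\sum_(x | x != u) (x \in M) = #|M|)%N by lia.
rewrite -sum1_card big_mkcond /= [RHS]big_mkcond; apply: eq_bigr => x _.
by have [->|_] := eqVneq x u; case: ifP => //= /uM; rewrite eqxx andbF.
Qed.

Lemma deg_le_add_star (x : G) : (deg x <= @deg add_star x)%N.
Proof.
have [->|xu] := eqVneq x u; first by rewrite deg_add_star_center leq_addr.
by rewrite deg_add_star // leq_addr.
Qed.

(** No degree drops, so no weight drops, and the weight of a new edge rises from 0 to a positive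
    value. *)
Lemma add_star_sombor (R : rcfType) : M != set0 -> sombor R G < sombor R add_star.
Proof.
case/set0Pn => w wM.
have leW (x y : G) : weight R x y <= @weight R add_star x y.
  rewrite {2}/weight /= /add_star_adj /weight; case: ifP => xy /=.
    by rewrite ler_hypot lerD // ler_pXn2r ?nnegrE // ler_nat deg_le_add_star.
  by case: ifP => _; rewrite ?hypot_ge0.
suff : sombor R G *+ 2 < sombor R add_star *+ 2 by rewrite ltrMn2r.
rewrite !sombor_weight; apply: (@ltr_sum_strict_at _ _ _ _ _ u) => // [x _|]; first exact: ler_sum.
apply: (@ltr_sum_strict_at _ _ _ _ _ w) => //.
have /andP[uw _] := uM _ wM; rewrite /weight (negbTE uw) /= /add_star_adj eqxx wM orbT.
apply: hypot_gt0; rewrite ltr0n (@adj_deg_gt0 add_star _ u) //=.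
by rewrite /add_star_adj eqxx wM !orbT.
Qed.
End AddStar.

(** * Moving neighbours of v over to a *)

Section Shift.
Variables (G : sgraph) (a v : G).
Hypothesis av : a != v.

Definition private_nbrs : {set G} := [set w | [&& adj v w, ~~ adj a w & w != a]].

Local Notation M := private_nbrs.

(** Pairs containing a are treated first, so the status of the pair a, v is unchanged: v is never in
    [M]. *)
Definition shift_adj : rel G := fun x y =>
  if x == a then adj a y || (y \in M)
  else if y == a then adj a x || (x \in M)
  else if x == v then adj v y && (y \notin M)
  else if y == v then adj v x && (x \notin M)
  else adj x y.

Fact shift_sym : symmetric shift_adj.
Proof.
move=> x y; rewrite /shift_adj; have [->|xa] := eqVneq x a.
  by case: eqVneq => [->|].
case: eqVneq => // ya; have [->|xv] := eqVneq x v; first by case: eqVneq => [->|].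
by case: eqVneq => // yv; rewrite adj_sym.
Qed.

Fact shift_irr : irreflexive shift_adj.
Proof.
move=> x; rewrite /shift_adj; case: eqVneq => [->|xa].
  by rewrite adj_irr inE eqxx !andbF.
by case: eqVneq => [->|]; rewrite adj_irr.
Qed.

Definition shift := SGraph shift_sym shift_irr.

Lemma deg_shift_target : @deg shift a = (deg a + #|M|)%N.
Proof.
rewrite /deg -cardsUI [X in (_ + X)%N](_ : _ = 0%N) ?addn0.
  by congr #|pred_of_set _|; apply/setP => x; rewrite !inE /= /shift_adj eqxx inE.
apply/eqP; rewrite cards_eq0; apply/eqP/setP => x; rewrite !inE.
by case: (adj a x); rewrite /= ?andbF.
Qed.

Lemma deg_shift_source : (@deg shift v + #|M|)%N = deg v.
Proof.
rewrite /deg -[RHS](cardsID M) addnC; congr (_ + _)%N; congr #|pred_of_set _|.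
  by apply/setP => x; rewrite !inE; case: (adj v x).
apply/setP => x; rewrite !inE /= /shift_adj eq_sym (negbTE av) eqxx.
case: eqVneq => [->|xa].
  by rewrite inE !adj_irr /= orbF adj_sym andbF.
by rewrite inE (negbTE xa) andbC.
Qed.

Lemma deg_shift x : x != a -> x != v -> @deg shift x = deg x.
Proof.
move=> xa xv; have [xM|xM] := boolP (x \in M); last first.
  congr #|pred_of_set _|; apply/setP => y.
  rewrite !inE /= /shift_adj (negbTE xa) (negbTE xv) (negbTE xM) orbF andbT.
  by do 2?[case: eqVneq => [->|_]; first by rewrite adj_sym].
have [vx nax _] : [/\ adj v x, ~~ adj a x & x != a].
  by apply/and3P; move: xM; rewrite inE.
(* A moved vertex exchanges its neighbour v for a; the remaining neighbours agree. *)
rewrite /deg [RHS](cardsD1 v) [LHS](cardsD1 (a : shift)) !inE /= [adj x v]adj_sym vx.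
congr (nat_of_bool _ + _)%N; first by rewrite /shift_adj (negbTE xa) eqxx xM orbT.
congr #|pred_of_set _|; apply/setP => y.
rewrite !inE /= /shift_adj (negbTE xa) (negbTE xv) xM andbF.
have [->|ya] := eqVneq y a; first by rewrite [adj x a]adj_sym (negbTE nax) !andbF.
by case: eqVneq.
Qed.

Lemma shift_edges : #|edges shift| = #|edges G|.
Proof.
apply: double_inj; rewrite -!handshake /=.
rewrite (bigD1 a) // (bigD1 v) /= 1?eq_sym // deg_shift_target.
rewrite [RHS](bigD1 a) // [in RHS](bigD1 v) /= 1?eq_sym // -deg_shift_source.
rewrite (eq_bigr (@deg G)) => [|x /andP[xa xv]]; first by lia.
exact: deg_shift.
Qed.

Lemma shift_adj_center : shift_adj a v = adj a v.
Proof. by rewrite /shift_adj eqxx inE adj_irr orbF. Qed.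

(** The vertices a and v stay linked, by their edge or through a common neighbour, which is not
    moved. A lost edge from v to y is then replaced by a walk from v to a followed by the new edge
    from a to y. *)
Lemma shift_connected : adj a v || [exists c, adj a c && adj v c] ->
  connected G -> connected shift.
Proof.
move=> near_av conG.
have sc := adj_connect_sym shift.
have cav : connect (@adj shift) a v.
  case/orP: near_av => [av1|/existsP[c /andP[ac vc]]].
    by apply: connect1; rewrite /= shift_adj_center.
  have ca : c != a by apply: contraTneq ac => ->; rewrite adj_irr.
  have cv : c != v by apply: contraTneq vc => ->; rewrite adj_irr.
  apply: (@connect_trans _ _ c); apply: connect1 => /=.
    by rewrite /shift_adj eqxx ac.
  by rewrite /shift_adj (negbTE ca) [v == a]eq_sym (negbTE av) (negbTE cv) eqxx vc inE ac andbF.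
have cavx x y : adj x y -> y != a -> x == v -> connect (@adj shift) x y.
  move=> xy ya /eqP xv; move: xy; rewrite xv => vy.
  have [yM|yM] := boolP (y \in M).
    apply: (@connect_trans _ _ a); first by rewrite sc.
    by apply: connect1; rewrite /= /shift_adj eqxx yM orbT.
  by apply: connect1; rewrite /= /shift_adj eq_sym (negbTE av) eqxx (negbTE ya) vy yM.
move=> x y; apply: connect_sub (conG x y) => {}x {}y xy.
have [xa|xa] := eqVneq x a.
  by apply: connect1; rewrite /= /shift_adj xa eqxx -xa xy.
have [ya|ya] := eqVneq y a.
  by apply: connect1; rewrite /= /shift_adj ya eqxx (negbTE xa) adj_sym -ya xy.
have [xv|xv] := eqVneq x v; first by apply: cavx => //; apply/eqP.
have [yv|yv] := eqVneq y v; first by rewrite sc; apply: cavx; rewrite 1?adj_sym //; apply/eqP.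
by apply: connect1; rewrite /= /shift_adj !ifN.
Qed.
End Shift.

(** This isolates the pairs that meet {a, v}: under a shift, all other weights stay the same. *)
Lemma sombor_split2 (R : rcfType) (G : sgraph) (a v : G) : a != v ->
  sombor R G *+ 2
  = (weight R a v + \sum_(y in ~: [set a; v]) (weight R a y + weight R v y)) *+ 2
    + \sum_(x in ~: [set a; v]) \sum_(y in ~: [set a; v]) weight R x y.
Proof.
move=> av; rewrite sombor_weight.
have -> : ~: [set a; v] = [set: G] :\ a :\ v.
  by apply/setP => x; rewrite !inE negb_or andbT andbC.
have wC := @weightC R G; have w0 := @weightxx R G.
have vA : v \in [set: G] :\ a by rewrite !inE eq_sym av.
transitivity (\sum_(x in [set: G]) \sum_(y in [set: G]) weight R x y).
  by apply: eq_big => x; rewrite ?inE // => _; apply: eq_bigl => y; rewrite inE.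
rewrite (sum_sym_setD1 a wC w0) ?inE // (sum_sym_setD1 v wC w0) //.
by rewrite (big_setD1 v vA) /= big_split /= addrA -mulrnDl addrA.
Qed.

(** Away from {a, v} nothing changes. The edge av, if present, does not lose, since the sum of
    squares of the two degrees grows. A common neighbour does not lose by [hypot_spread], a
    neighbour of a alone does not lose since deg a grows, and a moved neighbour gains strictly since
    deg v <= deg a < deg a + m. *)
Lemma shift_sombor (R : rcfType) (G : sgraph) (a v : G) (av : a != v) :
  (deg v <= deg a)%N -> private_nbrs G a v != set0 ->
  sombor R G < sombor R (shift G a v).
Proof.
move=> dva /set0Pn[w wM].
set S := shift G a v.
suff : sombor R G *+ 2 < sombor R S *+ 2 by rewrite ltrMn2r.
rewrite (sombor_split2 R G a v av) (sombor_split2 R S a v av).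
have va : v != a by rewrite eq_sym.
have mpos : (0 < #|private_nbrs G a v|)%N by apply/card_gt0P; exists w.
set m := #|_| in mpos.
have da : @deg S a = (deg a + m)%N by exact: deg_shift_target.
have dv : ((@deg S v)%:R : R) = (deg v)%:R - m%:R.
  by rewrite -(deg_shift_source G a v av) natrD addrK.
have spread (c : R) : 0 < c ->
    hypot (deg a)%:R c + hypot (deg v)%:R c
    <= hypot (@deg S a)%:R c + hypot (@deg S v)%:R c.
  by move=> c0; rewrite da natrD dv; apply: hypot_spread; rewrite ?ler_nat ?ler0n.
have inner : \sum_(x in ~: [set a; v]) \sum_(y in ~: [set a; v]) @weight R S x y
    = \sum_(x in ~: [set a; v]) \sum_(y in ~: [set a; v]) @weight R G x y.
  apply: eq_bigr => x; rewrite !inE negb_or => /andP[xa xv].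
  apply: eq_bigr => y; rewrite !inE negb_or => /andP[ya yv].
  by rewrite /weight !deg_shift //= /shift_adj (negbTE xa) (negbTE xv) (negbTE ya) (negbTE yv).
rewrite inner ltrD2r ltrMn2r /=.
have center : weight R a v <= @weight R S a v.
  rewrite /weight /= shift_adj_center //; case: ifP => // _.
  rewrite ler_hypot da dv natrD.
  have : (deg v)%:R <= (deg a)%:R :> R by rewrite ler_nat.
  have : 0 < m%:R :> R by rewrite ltr0n.
  nra.
apply: ler_ltD => //.
have outer y : y \in ~: [set a; v] ->
    @weight R S a y = (if adj a y || (y \in private_nbrs G a v) then
                       hypot (@deg S a)%:R (deg y)%:R else 0)
 /\ @weight R S v y = (if adj v y && (y \notin private_nbrs G a v) then
                       hypot (@deg S v)%:R (deg y)%:R else 0).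
  rewrite !inE negb_or => /andP[ya yv].
  rewrite /weight !(deg_shift G a v y) //= /shift_adj !eqxx.
  by rewrite (negbTE ya) (negbTE va) !inE (negbTE ya).
have moved y : y \in private_nbrs G a v ->
    hypot (deg v)%:R (deg y)%:R < hypot (@deg S a)%:R (deg y)%:R :> R.
  rewrite inE => /and3P[vy _ _]; rewrite ltr_hypot; last first.
    by rewrite ltr0n (@adj_deg_gt0 _ y v) // adj_sym.
  by rewrite ltrD2r ltr_pXn2r ?nnegrE // ltr_nat da; lia.
apply: (@ltr_sum_strict_at _ _ _ _ _ w).
- move: wM; rewrite !inE negb_or => /and3P[vw _ ->] /=.
  by apply: contraTneq vw => ->; rewrite adj_irr.
- move=> y yW; have [-> ->] := outer y yW.
  move: yW; rewrite !inE negb_or => /andP[ya yv].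
  rewrite ya andbT /weight; have [ay|nay] := boolP (adj a y).
    rewrite /= andbF andbT; case: ifP => vy; last first.
      rewrite !addr0 ler_hypot lerD2r ler_pXn2r ?nnegrE // ler_nat da leq_addr.
      by [].
    by apply: spread; rewrite ltr0n (@adj_deg_gt0 _ y v) // adj_sym.
  rewrite /= andbT; case: ifP => vy //=; rewrite add0r addr0 ltW // moved //.
  by rewrite inE vy nay ya.
- have wW : w \in ~: [set a; v].
    move: wM; rewrite !inE negb_or => /and3P[vw _ ->] /=.
    by apply: contraTneq vw => ->; rewrite adj_irr.
  have [-> ->] := outer w wW; rewrite wM orbT andbF addr0.
  move: (moved w wM) (wM); rewrite inE => lt /and3P[vw /negbTE aw _].
  by rewrite /weight aw vw add0r.
Qed.

(** * The extremal value and the structure of nested graphs *)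

Definition H_sombor (R : rcfType) (n nu : nat) : R :=
  (n%:R - nu%:R - 2%:R) * hypot (n%:R - 1) 1
  + nu%:R * hypot (n%:R - 1) 2
  + hypot (n%:R - 1) (nu%:R + 1)
  + nu%:R * hypot (nu%:R + 1) 2.

(** The structure extracted from maximality. By symmetry of [adj], the third field places both ends
    of any edge avoiding u and a among the neighbours of a. *)
Record nested (G : sgraph) (u a : G) : Prop := Nested {
  nested_neq : u != a;
  nested_dom : forall y, adj u y = (y != u);
  nested_sub : forall x y, adj x y -> x != u -> y != u -> x != a -> adj a x }.

Section Nested.
Variables (G : sgraph) (u a : G).
Hypothesis nG : nested G u a.

Definition nest : {set G} := [set y | adj a y && (y != u)].
Definition inner_deg (x : G) := #|[set y in nest | adj x y]|.

Local Notation K := nest.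
Local Notation k := #|nest|.
Let ua : u != a. Proof. exact: nested_neq nG. Qed.
Let au : a != u. Proof. by rewrite eq_sym ua. Qed.
Let udom y : adj u y = (y != u). Proof. exact: nested_dom nG y. Qed.

Lemma nestP y : y \in K -> [/\ adj a y, y != u & y != a].
Proof.
rewrite inE => /andP[ay yu]; split=> //.
by apply: contraTneq ay => ->; rewrite adj_irr.
Qed.

(** These turn out to be the pendent vertices, attached to u only. *)
Definition outer : {set G} := [set y | [&& y != u, y != a & y \notin K]].
Local Notation Z := outer.

Lemma nest_setI : ~: [set u; a] :&: K = K.
Proof.
apply/setIidPr/subsetP => x /nestP[_ xu xa].
by rewrite !inE negb_or xu xa.
Qed.

Lemma nest_setD : ~: [set u; a] :\: K = Z.
Proof.
apply/setP => x; rewrite in_setD in_setC in_set2 negb_or [RHS]in_set.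
by rewrite andbC andbA.
Qed.

Lemma big_nested (V : nmodType) (F : G -> V) :
  \sum_x F x = F u + F a + \sum_(x in K) F x + \sum_(x in Z) F x.
Proof.
rewrite (bigD1 u) //= (bigD1 a) //= -!addrA; congr (_ + (_ + _)).
rewrite (eq_bigl (fun x => x \in ~: [set u; a])) => [|x]; last by rewrite /= !inE negb_or.
by rewrite (big_setID K) /= nest_setI nest_setD.
Qed.

Lemma card_nested : (#|G| = 2 + k + #|Z|)%N.
Proof.
have := big_nested nat (fun=> 1%N).
by rewrite !sum1_card => ->.
Qed.

Lemma deg_dom : deg u = (1 + k + #|Z|)%N.
Proof.
apply: succn_inj; rewrite !addSn add0n -[RHS]card_nested /deg -[RHS](cardsC [set u]) cards1 add1n.
by congr S; congr #|pred_of_set _|; apply/setP => x; rewrite !inE udom.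
Qed.

Lemma deg_second : deg a = k.+1.
Proof.
rewrite /deg (cardsD1 u) inE adj_sym udom au add1n; congr S.
by congr #|pred_of_set _|; apply/setP => x; rewrite !inE andbC.
Qed.

Lemma adj_nest x y : adj x y -> x != u -> y != u -> x != a -> x \in K.
Proof. by move=> xy xu yu xa; rewrite inE xu andbT (nested_sub _ _ _ nG x y). Qed.

Lemma deg_outer y : y \in Z -> deg y = 1%N.
Proof.
rewrite inE => /and3P[yu ya yK]; rewrite -(cards1 u) /deg.
congr #|pred_of_set _|; apply/setP => x; rewrite !inE.
have [->|xu] := eqVneq x u; first by rewrite adj_sym udom yu.
by apply: contraNF yK => yx; apply: adj_nest yx yu xu ya.
Qed.

Lemma deg_nest y : y \in K -> deg y = (inner_deg y).+2.
Proof.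
move=> yK; have [ay yu ya] := nestP y yK.
rewrite /deg (cardsD1 u) inE adj_sym udom yu add1n; congr S.
rewrite (cardsD1 a) !inE au adj_sym ay add1n; congr S.
congr #|pred_of_set _|; apply/setP => x; rewrite !inE.
have [->|xa] := eqVneq x a; first by rewrite adj_irr.
have [->|xu] := eqVneq x u; first by rewrite /= andbF.
rewrite /= andbT; have [yx|] := boolP (adj y x); last by rewrite andbF.
by rewrite andbT; rewrite adj_sym in yx; rewrite (nested_sub _ _ _ nG x y).
Qed.

(** Handshake over u, a, K and Z. The sum of inner degrees is twice the number of edges inside K,
    hence the doubled form. *)
Lemma nested_edges :
  ((#|edges G|).*2 = (1 + k + #|Z| + k).*2 + \sum_(x in K) inner_deg x)%N.
Proof.
have E : (\sum_(x : G) deg x = deg u + deg a + \sum_(x in K) deg x + \sum_(x in Z) deg x)%N.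
  exact: (big_nested nat (@deg G)).
rewrite -handshake E.
rewrite /= deg_dom deg_second (eq_bigr _ deg_outer) sum1_card.
rewrite (eq_bigr (fun x => (2 + inner_deg x)%N)) => [|x /deg_nest->//].
rewrite big_split /= sum_nat_const; lia.
Qed.

Lemma inner_deg_lt x : x \in K -> (inner_deg x < k)%N.
Proof.
move=> xK; rewrite (cardsD1 x K) xK add1n ltnS subset_leq_card //.
apply/subsetP => y; rewrite !inE => /andP[/andP[-> ->] xy]; rewrite !andbT.
by apply: contraTneq xy => ->; rewrite adj_irr.
Qed.

(** Each inner neighbour of x has inner degree at least 1, so the others contribute at least as much
    as x. Consequently no inner degree exceeds the number of edges inside K. *)
Lemma inner_deg_double x : x \in K -> ((inner_deg x).*2 <= \sum_(y in K) inner_deg y)%N.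
Proof.
move=> xK; rewrite (big_setD1 x xK) /= -addnn leq_add2l.
rewrite {1}/inner_deg -sum1_card big_mkcond [leqRHS]big_mkcond /=.
apply: leq_sum => y _; rewrite in_setD1 !in_set.
case: ifP => // /andP[/andP[ay yu] xy].
have -> : y != x by apply: contraTneq xy => ->; rewrite adj_irr.
rewrite ay yu /=; apply/card_gt0P; exists x.
by rewrite inE xK adj_sym.
Qed.

(** Split at u and a: a vertex of Z contributes only its edge to u, and the last sum counts every
    edge inside K twice. *)
Lemma nested_sombor (R : rcfType) : sombor R G *+ 2 =
  (hypot (deg u)%:R k.+1%:R
   + \sum_(y in K) (hypot (deg u)%:R (deg y)%:R + hypot k.+1%:R (deg y)%:R)
   + hypot (deg u)%:R 1 *+ #|Z|) *+ 2
  + \sum_(x in K) \sum_(y in K) weight R x y.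
Proof.
rewrite (sombor_split2 R G u a ua); congr (_ *+ 2 + _).
  rewrite -addrA; congr (_ + _); first by rewrite /weight udom au deg_second.
  rewrite (big_setID K) /= nest_setI nest_setD; congr (_ + _).
    apply: eq_bigr => y yK; have [ay yu ya] := nestP y yK.
    by rewrite /weight udom yu ay deg_second.
  rewrite -sumr_const; apply: eq_bigr => y yZ.
  move: (yZ); rewrite inE => /and3P[yu _ yK].
  rewrite /weight udom yu (deg_outer y yZ) ifF ?addr0 //.
  by apply: contraNF yK => ay; rewrite inE ay.
rewrite (big_setID K) /= nest_setI nest_setD [X in _ + X]big1 ?addr0.
  apply: eq_bigr => x xK; rewrite (big_setID K) /= nest_setI nest_setD.
  rewrite [X in _ + X]big1 ?addr0 // => y; rewrite inE => /and3P[yu ya yK].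
  rewrite /weight ifF //; apply: contraNF yK => xy; have [_ xu _] := nestP x xK.
  by apply: (@adj_nest y x); rewrite 1?adj_sym.
move=> x; rewrite inE => /and3P[xu xa xK]; apply: big1 => y.
rewrite !inE negb_or => /andP[yu ya]; rewrite /weight ifF //.
by apply: contraNF xK => xy; apply: adj_nest xy xu yu xa.
Qed.
End Nested.

(** * Strict loss when K contains edges *)

Lemma nested_sombor_lt (R : rcfType) (G : sgraph) (u a : G) (nu : nat) :
  nested G u a -> #|edges G| = (deg u + nu)%N -> (nu < deg u)%N ->
  (#|nest G u a| < nu)%N -> sombor R G < H_sombor R #|G| nu.
Proof.
move=> nG mE nuN knu.
have := nested_edges G u a nG; rewrite mE -(deg_dom G u a nG) => sumE.
have dE := deg_dom G u a nG; have nE := card_nested G u a nG.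
have SE := nested_sombor G u a nG R.
have ltk := inner_deg_lt G u a; have dbl := inner_deg_double G u a.
have dK := deg_nest G u a nG.
move: sumE dE nE SE ltk dbl dK knu.
set K := nest G u a; set ideg := inner_deg G u a; set z := #|outer G u a|.
move kE: #|K| => k; move NE: (deg u) => N.
move=> sumE dE nE SE ltk dbl dK knu.
have [e e0 nuE] : exists2 e, (0 < e)%N & nu = (k + e)%N by exists (nu - k)%N; lia.
have {}sumE : (\sum_(x in K) ideg x = e.*2)%N by lia.
(* Since e > 0, some vertex of K has a positive inner degree, and inner degrees are below k. *)
have k2 : (1 < k)%N.
  have [x /andP[xK ix]|none] := pickP (fun x => (x \in K) && (0 < ideg x)%N).
    exact: leq_ltn_trans ix (ltk x xK).
  have : (\sum_(x in K) ideg x = 0)%N; last by lia.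
  by apply: big1 => x xK; have := none x; rewrite xK /=; lia.
(* Here A = nu + 1 is the degree in H of the fixed pendent vertex; the [F] below is the weight in H
   of its edges to vertices of degree 2. *)
pose kR : R := k%:R; pose eR : R := e%:R; pose NR : R := N%:R; pose A := kR + eR + 1.
have k2R : 2 <= kR by rewrite ler_nat.
have e1R : 1 <= eR by rewrite ler1n.
have NA : A <= NR by rewrite /A -natrD natr1 ler_nat; lia.
pose F := hypot A 2; have F0 : 0 < F by apply: hypot_gt0.
pose sg := (kR + 1) / hypot NR (kR + 1).
have A4 : 4 <= A by rewrite /A; lra.
have N0 : 0 < NR by lra.
have hN0 y : 0 < hypot NR y by rewrite hypotC hypot_gt0.
have sumR : \sum_(x in K) ((ideg x)%:R : R) = 2 * eR.
  by rewrite -natr_sum sumE -muln2 natrM mulrC.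
have bound_i x : x \in K -> (ideg x)%:R <= kR - 1 :> R /\ (ideg x)%:R <= eR.
  move=> xK; split; last by rewrite ler_nat; have := dbl x xK; lia.
  by rewrite lerBrDr natr1 ler_nat ltk.
have degR x : x \in K -> (deg x)%:R = (ideg x)%:R + 2 :> R.
  by move=> /dK->; rewrite -addn2 natrD.
(* For the edge to u, use the tangent at i + 2 evaluated at 2, whose slope is at most [sg] because i
   + 2 <= k + 1. For the edge to a, use [hypot_gap] and (i + 2)^2 - 4 <= (k + 3) i, which follows
   from i <= k - 1. *)
have spoke x : x \in K ->
    hypot NR (deg x)%:R + hypot (kR + 1) (deg x)%:R
    <= hypot NR 2 + F - (A ^+ 2 - (kR + 1) ^+ 2) / (2 * F)
       + (sg + (kR + 3) / (2 * F)) * (ideg x)%:R.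
  move=> xK; have [ik _] := bound_i x xK; rewrite degR //.
  move: ik (ler0n R (ideg x)); set i : R := (ideg x)%:R => ik i0.
  have := hypot_tangent R NR (i + 2) 2 N0.
  have : (i + 2) / hypot NR (i + 2) <= sg by apply: hypot_slope_mono; lra.
  move/(ler_wpM2l i0).
  have := hypot_gap R A 2 (kR + 1) (i + 2) ltac:(lra).
  rewrite -/F.
  have : (A ^+ 2 - (kR + 1) ^+ 2 - (kR + 3) * i) / (2 * F)
        <= (A ^+ 2 + 2 ^+ 2 - ((kR + 1) ^+ 2 + (i + 2) ^+ 2)) / (2 * F).
    rewrite ler_pM2r ?invr_gt0 ?mulr_gt0 //; nra.
  have -> : (A ^+ 2 - (kR + 1) ^+ 2 - (kR + 3) * i) / (2 * F)
     = (A ^+ 2 - (kR + 1) ^+ 2) / (2 * F) - (kR + 3) / (2 * F) * i by ring.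
  lra.
(* Both end degrees of an inner edge are at most k + 1 and at most e + 2, hence at most their mean
   (A + 2) / 2. So F^2 - f^2 >= A^2 + 4 - (A + 2)^2 / 2 = (A - 2)^2 / 2. *)
pose W := F - (A - 2) ^+ 2 / (4 * F).
have chord x : x \in K -> \sum_(y in K) weight R x y <= W * (ideg x)%:R.
  move=> xK; rewrite mulr_natr /ideg /inner_deg -/K -sumr_const big_mkcond.
  rewrite [leRHS]big_mkcond /=; apply: ler_sum => y _; rewrite in_set /weight.
  have [yK|] := boolP (y \in K) => //=; case: ifP => // _.
  have [ixk ixe] := bound_i x xK; have [iyk iye] := bound_i y yK.
  rewrite (degR x xK) (degR y yK).
  move: ixk ixe iyk iye (ler0n R (ideg x)) (ler0n R (ideg y)).
  set i : R := (ideg x)%:R; set j : R := (ideg y)%:R => ixk ixe iyk iye i0 j0.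
  have := hypot_gap R A 2 (i + 2) (j + 2) ltac:(lra); rewrite -/F.
  have : (A - 2) ^+ 2 / (4 * F) <= (A ^+ 2 + 2 ^+ 2 - ((i + 2) ^+ 2 + (j + 2) ^+ 2)) / (2 * F).
    rewrite ler_pdivlMr ?mulr_gt0 // mulrAC ler_pdivrMr ?mulr_gt0 //.
    suff: (A - 2) ^+ 2 <= 2 * (A ^+ 2 + 2 ^+ 2 - ((i + 2) ^+ 2 + (j + 2) ^+ 2)) by nra.
    have sq (t : R) : 0 <= t -> t <= kR - 1 -> t <= eR -> (t + 2) ^+ 2 <= ((A + 2) / 2) ^+ 2.
      move=> t0 t1 t2; rewrite ler_pXn2r ?nnegrE /A //; lra.
    have := sq i i0 ixk ixe; have := sq j j0 iyk iye; nra.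
  rewrite /W; lra.
have spokes : \sum_(x in K) (hypot NR (deg x)%:R + hypot (kR + 1) (deg x)%:R)
    <= kR * (hypot NR 2 + F - (A ^+ 2 - (kR + 1) ^+ 2) / (2 * F))
       + (sg + (kR + 3) / (2 * F)) * (2 * eR).
  rewrite -sumR mulr_sumr [kR * _]mulr_natl -kE -sumr_const -big_split.
  exact: ler_sum.
have chords : \sum_(x in K) \sum_(y in K) weight R x y <= W * (2 * eR).
  by rewrite -sumR mulr_sumr; apply: ler_sum.
(* The edge ua becomes heavier by at least e * [sg] in H, which offsets half of the loss 2 e * [sg]
   allowed by [spokes]. *)
have hkA : hypot NR (kR + 1) + eR * sg <= hypot NR A.
  have := hypot_tangent R NR (kR + 1) A N0; rewrite -/sg.
  by have -> : A - (kR + 1) = eR by rewrite /A; ring.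
have sgF : sg <= (kR + 1) / F.
  rewrite /sg ler_pM2l; last by lra.
  by rewrite lef_pV2 ?posrE // /F ler_hypot; nra.
(* In H, e of the pendent edges at u become edges to vertices of degree 2. This is the source of
   strictness. *)
have g12 : hypot NR 1 < hypot NR 2 by rewrite ltr_hypot //; lra.
have zR : (z%:R : R) = NR - 1 - kR.
  by rewrite /NR dE !natrD -/kR; ring.
suff : sombor R G *+ 2 < H_sombor R #|G| nu *+ 2 by rewrite ltrMn2r.
rewrite SE /H_sombor nE.
have nR : ((2 + k + z)%:R : R) = NR + 1.
  by rewrite natr1; congr (_%:R); lia.
have nuR : (nu%:R : R) = kR + eR by rewrite nuE natrD.
have kSR : (k.+1%:R : R) = kR + 1 by rewrite -natr1.
rewrite nR nuR kSR -/NR addrK -/A -/F -(mulr_natl (hypot NR 1)) zR.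
move: (\sum_(y in K) _) spokes (\sum_(x in K) _) chords => S1 spokes S2 chords.
have e0R : 0 < eR by lra.
have eg12 : eR * hypot NR 1 < eR * hypot NR 2 by rewrite ltr_pM2l.
have esgF := ler_wpM2l (ltW e0R) sgF.
have t0 : 0 < F^-1 by rewrite invr_gt0.
(* This is 4 times the slack left by the non-strict estimates, after bounding [sg] by (k + 1) / F.
   The polynomial vanishes at k = 2, e = 1, so it cannot supply strictness itself. *)
have key : 0 <= F^-1 * (eR * (2 * (2 * kR ^+ 2 + kR * eR - 6) + (kR + eR - 1) ^+ 2 - 4 * (kR + 1))).
  rewrite mulr_ge0 ?(ltW t0) // mulr_ge0 ?(ltW e0R) //; nra.
move: spokes chords esgF; rewrite /W !invfM /A.
move: (F^-1) t0 key => t t0 key spokes chords esgF.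
rewrite !mulr2n; lra.
Qed.

(** * Nested graphs without edges inside K *)

Section Flat.
Variables (G : sgraph) (u a : G).
Hypothesis nG : nested G u a.
Local Notation K := (nest G u a).
Local Notation k := #|K|.
Hypothesis flat : (\sum_(x in K) inner_deg G u a x = 0)%N.

Let flat_nadj x y : x \in K -> y \in K -> adj x y = false.
Proof.
move=> xK yK; apply/negP => xy.
have /eqP : (\sum_(x in K) inner_deg G u a x = 0)%N by [].
rewrite sum_nat_eq0 => /forall_inP/(_ x xK); apply/negP; rewrite -lt0n.
by apply/card_gt0P; exists y; rewrite inE yK xy.
Qed.

Let deg2 x : x \in K -> deg x = 2%N.
Proof.
move=> xK; rewrite (deg_nest G u a nG) // /inner_deg -[RHS]addn0 -addn2 addnC; congr (_ + _)%N.
apply/eqP; rewrite cards_eq0; apply/eqP/setP => y; rewrite in_set in_set0.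
by apply/negP => /andP[/(flat_nadj x y xK)->].
Qed.

Lemma flat_edges : #|edges G| = (deg u + k)%N.
Proof.
by have := nested_edges G u a nG; rewrite flat addn0 -(deg_dom G u a nG) => /double_inj.
Qed.

Lemma flat_sombor (R : rcfType) : sombor R G = H_sombor R #|G| k.
Proof.
have SE := nested_sombor G u a nG R.
apply/eqP; rewrite -(eqr_pMn2r (n := 2)) // SE [X in _ + X]big1 ?addr0 => [|x xK]; last first.
  by apply: big1 => y yK; rewrite /weight flat_nadj.
apply/eqP; congr (_ *+ 2).
rewrite (eq_bigr (fun=> hypot (deg u)%:R 2 + hypot k.+1%:R 2)) => [|x /deg2->//].
rewrite sumr_const /H_sombor (card_nested G u a nG) (deg_dom G u a nG).
rewrite -(mulr_natl (_ + _)) -(mulr_natl (hypot _ _)) !natrD [k%:R + 1]addrC.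
have -> : 2 + k%:R + #|outer G u a|%:R - 1 = 1 + k%:R + #|outer G u a|%:R :> R by ring.
ring.
Qed.

Lemma flat_adjE x y : adj x y = (x != y) &&
  [|| x == u, y == u, (x == a) && (y \in K) | (y == a) && (x \in K)].
Proof.
have [<-|xy] := eqVneq x y; first by rewrite adj_irr.
have [xu|xu] := eqVneq x u; first by rewrite xu (nested_dom _ _ _ nG) eq_sym -xu xy.
have [yu|yu] := eqVneq y u; first by rewrite yu adj_sym (nested_dom _ _ _ nG) xu.
have [xa|xa] := eqVneq x a.
  have aK : a \notin K by rewrite inE adj_irr.
  by rewrite xa /= inE yu (negbTE aK) andbF orbF andbT.
have [ya|ya] := eqVneq y a; first by rewrite ya /= inE xu andbT adj_sym.
rewrite /=; apply/negP => axy; suff: adj x y = false by rewrite axy.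
apply: flat_nadj; first exact: (adj_nest G u a nG x y).
by apply: (adj_nest G u a nG y x); rewrite 1?adj_sym.
Qed.

Lemma flat_isomorphic : isomorphic G (Hgraph #|G| k).
Proof.
have ua := nested_neq _ _ _ nG.
(* Listing u, a, K, Z in this order makes the position in the list an isomorphism: u goes to 0, a to
   1, and K to 2, ..., k + 1. *)
pose L := u :: a :: enum K ++ enum (outer G u a).
have sizeL : size L = #|G|.
  by rewrite /= size_cat -!cardE (card_nested G u a nG) !addSn.
have inL x : x \in L.
  rewrite !inE mem_cat !mem_enum [x \in outer G u a]inE.
  by case: (x == u); case: (x == a); case: (x \in K).
have ltL x : (index x L < #|G|)%N by rewrite -sizeL index_mem.
pose f (x : G) : Hgraph #|G| k := Ordinal (ltL x).
have f_inj : injective f.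
  move=> x y fxy; have {}fxy : index x L = index y L := congr1 val fxy.
  by rewrite -[x](nth_index u (inL x)) fxy nth_index.
have K_u : u \notin K by rewrite inE eqxx andbF.
have K_a : a \notin K by rewrite inE adj_irr.
have f0 x : (val (f x) == 0%N) = (x == u).
  by rewrite /= [RHS]eq_sym; case: (u == x).
have f1 x : (val (f x) == 1%N) = (x == a).
  rewrite /= [RHS]eq_sym; have [<-|_] := eqVneq u x; first by rewrite [RHS]eq_sym (negbTE ua).
  by case: (a == x).
have f2 x : (2 <= val (f x) < k + 2)%N = (x \in K).
  rewrite /=; have [<-|ux] := eqVneq u x; first by rewrite (negbTE K_u).
  have [<-|ax] := eqVneq a x; first by rewrite (negbTE K_a).
  rewrite addn2 !ltnS /= index_cat mem_enum cardE.
  by case: ifP => xK; [rewrite index_mem mem_enum | rewrite ltnNge leq_addr].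
exists f; first by apply: inj_card_bij => //; rewrite card_ord.
move=> x y; rewrite flat_adjE /= /H_adj /star_adj /added_adj.
rewrite !f0 !f1 !f2 (inj_eq f_inj).
have [<-|xy] := eqVneq x y; last by rewrite /= -!orbA.
by have [->|] := eqVneq x a; rewrite ?(negbTE K_a).
Qed.
End Flat.

(** * Cyclomatic number and index of H *)

Lemma cyclomatic_connected (G : sgraph) (x : G) (nu : nat) :
  connected G -> (cyclomatic G = nu%:Z) <-> ((#|edges G|).+1 = #|G| + nu)%N.
Proof. by move=> /(connected_num_components G x) c1; rewrite /cyclomatic c1; lia. Qed.

Section Hgraph.
Variables (n nu : nat).
Hypothesis hnu : (nu + 2 <= n)%N.

(** H is itself nested, with u = 0, a = 1 and K = {2, ..., nu + 1} free of edges, so the general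
    formulas for this case apply. *)
Lemma Hgraph_cyclomatic_sombor (R : rcfType) :
  cyclomatic (Hgraph n nu) = nu%:Z /\ sombor R (Hgraph n nu) = H_sombor R n nu.
Proof.
have n0 : (0 < n)%N by lia.
have n1 : (1 < n)%N by lia.
pose u : Hgraph n nu := Ordinal n0; pose a : Hgraph n nu := Ordinal n1.
have udom (y : Hgraph n nu) : adj u y = (y != u).
  rewrite /= /H_adj /star_adj /added_adj /= andbF orbF andbT eq_sym.
  by case: (y != u).
have nH : nested (Hgraph n nu) u a.
  split=> // x y; rewrite /= /H_adj /star_adj /added_adj -!val_eqE /=; lia.
have inK (x : Hgraph n nu) : (x \in nest _ u a) = (2 <= val x < nu + 2)%N.
  rewrite inE /= /H_adj /star_adj /added_adj -!val_eqE /=; lia.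
have flat : (\sum_(x in nest _ u a) inner_deg _ u a x = 0)%N.
  apply: big1 => x; rewrite inK => xK; apply/eqP; rewrite cards_eq0.
  apply/eqP/setP => y; rewrite in_set inK in_set0; move: xK.
  rewrite /= /H_adj /star_adj /added_adj -!val_eqE /=; lia.
have cardK : #|nest (Hgraph n nu) u a| = nu.
  rewrite -sum1_card (eq_bigl (fun x : 'I_n => true && (2 <= x)%N && (x < nu + 2)%N)) => [|x].
    rewrite -(big_mkord (fun i => true && (2 <= i)%N && (i < nu + 2)%N) (fun=> 1%N)).
    by rewrite -big_nat_widen // -big_nat_widenl // sum_nat_const_nat muln1 addnK.
  exact: inK.
have cardH : #|Hgraph n nu| = n by rewrite card_ord.
split; last by rewrite (flat_sombor _ _ _ nH flat) cardK cardH.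
apply/(cyclomatic_connected _ u); first exact: dominating_connected udom.
rewrite (flat_edges _ _ _ nH flat) cardK cardH.
have := card_nested _ _ _ nH; rewrite cardH (deg_dom _ _ _ nH); lia.
Qed.
End Hgraph.

(** * Joining the components of a graph *)

Section Join.
Variables (G : sgraph) (u : G).

(** One representative for each component that does not contain u. *)
Definition other_roots : {set G} :=
  [set x in roots (@adj G) | x != fingraph.root (@adj G) u].

Lemma other_roots_nadj x : x \in other_roots -> ~~ adj u x && (x != u).
Proof.
rewrite !inE => /andP[/eqP rx xu]; apply/andP; split.
  apply: contraNN xu => ux; rewrite -rx eq_sym.
  by rewrite root_connect ?connect1 //; exact: adj_connect_sym.
by apply: contraNneq xu => <-; rewrite rx.
Qed.

Lemma card_other_roots : num_components G = (#|other_roots|).+1.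
Proof.
rewrite /num_components /n_comp_mem [LHS](cardD1 (fingraph.root (@adj G) u)).
rewrite -[RHS]/(true + #|other_roots|)%N; congr (nat_of_bool _ + _)%N.
  by rewrite inE /= andbT; exact/roots_root/adj_connect_sym.
apply: eq_card => x.
by rewrite !inE andbT andbC.
Qed.

Definition join_components : sgraph := add_star G u other_roots other_roots_nadj.

Lemma join_connected : connected join_components.
Proof.
have sc := adj_connect_sym join_components.
have sub x y : connect (@adj G) x y -> connect (@adj join_components) x y.
  apply: connect_sub => {}x {}y xy; apply: connect1.
  by rewrite /= /add_star_adj xy.
have ux x : connect (@adj join_components) u x.
  have rx := connect_root (@adj G) x.
  apply: (@connect_trans _ _ (fingraph.root (@adj G) x)); last by rewrite sc sub.
  have [->|ru] := eqVneq (fingraph.root (@adj G) x) (fingraph.root (@adj G) u).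
    exact/sub/connect_root.
  apply: connect1; rewrite /= /add_star_adj eqxx inE ru andbT /=.
  by rewrite [_ \in _]roots_root ?orbT //; exact: adj_connect_sym.
by move=> x y; apply: connect_trans (ux y); rewrite sc.
Qed.

(** With c components, c - 1 edges are added and c - 1 components disappear. *)
Lemma join_cyclomatic : cyclomatic join_components = cyclomatic G.
Proof.
rewrite /cyclomatic (connected_num_components join_components u join_connected).
rewrite card_other_roots add_star_edges /=; lia.
Qed.
End Join.

(** * Structure of maximal graphs *)

Section Maximal.
Variables (R : rcfType) (n nu : nat) (G : sgraph).
Hypothesis hG : sombor_maximal R n nu G.

Lemma maximal_connected : connected G.
Proof.
have [cG nuG maxG] := hG => u v.
have := maxG (join_components G u) cG.
rewrite join_cyclomatic => /(_ nuG) le.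
have [M0|M0] := eqVneq (other_roots G u) set0; last first.
  by have := add_star_sombor _ u _ (other_roots_nadj G u) R M0; rewrite ltNge le.
rewrite -root_connect; last exact: adj_connect_sym.
have : fingraph.root (@adj G) v \notin other_roots G u by rewrite M0 inE.
have rv : fingraph.root (@adj G) v \in roots (@adj G).
  exact: roots_root (@adj_connect_sym G) v.
by rewrite in_set rv /= negbK eq_sym.
Qed.

(** Otherwise the shift from v to a is a competitor of larger index: it stays connected with the
    same number of edges, hence keeps the cyclomatic number. *)
Lemma maximal_nbrs (a v w : G) : a != v -> (deg v <= deg a)%N ->
  adj a v || [exists c, adj a c && adj v c] -> adj v w -> w != a -> adj a w.
Proof.
have [cG nuG maxG] := hG; have conG := maximal_connected.
move=> av dva near vw wa; apply: contraT => naw.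
have M0 : private_nbrs G a v != set0.
  by apply/set0Pn; exists w; rewrite inE vw naw.
have := shift_sombor R G a v av dva M0; rewrite ltNge maxG //.
apply/(cyclomatic_connected (shift G a v) a nu (shift_connected G a v av near conG)).
rewrite shift_edges //; exact/(cyclomatic_connected G a nu conG).
Qed.

Lemma maximal_nested : (1 < n)%N -> exists u a : G, nested G u a.
Proof.
have [cG _ _] := hG => n1.
have /card_gt0P[x0 _] : (0 < #|G|)%N by lia.
have [u _ umax] := @arg_maxnP G x0 xpredT (@deg G) isT.
have udom y : adj u y = (y != u).
  apply/idP/idP => [uy|yu]; first by apply: contraTneq uy => ->; rewrite adj_irr.
  (* The closed neighbourhood of u is closed under adjacency, as deg u is maximal; connectedness
     then makes it the whole graph. *)
  have cl : closed (@adj G) [pred z | (z == u) || adj u z].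
    apply: intro_closed; first exact: adj_connect_sym.
    move=> x z xz; rewrite !inE; have [->//|zu /=] := eqVneq z u.
    have [xu|xu /= ux] := eqVneq x u; first by rewrite -xu.
    by apply: (maximal_nbrs u x z) => //; [rewrite eq_sym | exact: umax | rewrite ux].
  have := closed_connect cl (maximal_connected u y).
  by rewrite !inE eqxx (negbTE yu) /= => <-.
have /card_gt0P[a0 a0u] : (0 < #|predC1 u|)%N by rewrite cardC1; lia.
have [a au amax] := @arg_maxnP G a0 (predC1 u) (@deg G) a0u.
exists u, a; split=> //; first by rewrite eq_sym.
move=> y w yw yu wu ya.
have [wa|wa] := eqVneq w a; first by rewrite adj_sym -wa.
(* The dominating vertex u is a common neighbour of a and w, and deg w <= deg a by the choice of
   a. *)
apply: (maximal_nbrs a w y) => //; [by rewrite eq_sym | exact: amax | | by rewrite adj_sym].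
apply/orP; right; apply/existsP; exists u.
by rewrite ![adj _ u]adj_sym !udom wu andbT.
Qed.
End Maximal.

(** * Comparison of a maximal graph with H *)

Theorem theorem3p5 (R : rcfType) (n nu : nat) (hnu : (nu + 2 <= n)%N)
    (G : sgraph) (hG : sombor_maximal R n nu G) :
  isomorphic G (Hgraph n nu) /\
  sombor R G =
    (n%:R - nu%:R - 2%:R) * Num.sqrt ((n%:R - 1) ^+ 2 + 1)
    + nu%:R * Num.sqrt ((n%:R - 1) ^+ 2 + 4%:R)
    + Num.sqrt ((n%:R - 1) ^+ 2 + (nu%:R + 1) ^+ 2)
    + nu%:R * Num.sqrt ((nu%:R + 1) ^+ 2 + 4%:R).
Proof.
have [cG nuG maxG] := hG.
have n1 : (1 < n)%N by lia.
have [u [a nG]] := maximal_nested R n nu G hG n1.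
have := nuG => /(cyclomatic_connected _ u _ (maximal_connected R n nu G hG)) mE.
have cardE : #|G| = (deg u).+1 by rewrite (card_nested _ _ _ nG) (deg_dom _ _ _ nG).
have sumE := nested_edges _ _ _ nG.
rewrite -(deg_dom _ _ _ nG) in sumE.
(* By [sumE] and [mE], nu - k edges lie inside K, so k <= nu. If k < nu, then H has larger index,
   against maximality; if k = nu, no edge lies inside K. *)
have [k_lt|k_ge] := ltnP #|nest G u a| nu.
  have [cH sH] := Hgraph_cyclomatic_sombor n nu hnu R.
  have : sombor R G < H_sombor R #|G| nu.
    by apply: nested_sombor_lt nG _ _ k_lt; lia.
  by rewrite ltNge cG -sH maxG // card_ord.
have kE : #|nest G u a| = nu by lia.
have flat : (\sum_(x in nest G u a) inner_deg G u a x = 0)%N by lia.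
have iso := flat_isomorphic _ _ _ nG flat.
have SE := flat_sombor _ _ _ nG flat R.
rewrite cG kE in iso SE; split=> //; rewrite SE /H_sombor /hypot expr1n.
by have -> : 2 ^+ 2 = 4%:R :> R by ring.
Qed.
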